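(* Let $m,n\ge 2$ be integers. There exists a $(\mathbb{Z}_2)^{m+n}$-distance magic labeling of the Cartesian product $C_{2^m}\square C_{2^n}$ if and only if $m=n$.
   Context: $C_k$ denotes the cycle on $k\ge 3$ vertices. The Cartesian product $G\square H$ of graphs $G,H$ has vertex set $V(G)\times V(H)$; $(g,h)$ and $(g',h')$ are adjacent iff either $g=g'$ and $h$ is adjacent to $h'$ in $H$, or $h=h'$ and $g$ is adjacent to $g'$ in $G$. For a finite simple graph $G=(V,E)$ and an Abelian group $\Gamma$ (written additively) with $|\Gamma|=|V|$, a $\Gamma$-distance magic labeling of $G$ is a bijection $\ell\colon V\to\Gamma$ for which there exists $\mu\in\Gamma$ such that $\sum_{u\in N(v)}\ell(u)=\mu$ for every $v\in V$, where $N(v)$ is the open neighborhood of $v$. *)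

(* Defs.v *)
From mathcomp Require Import all_boot all_algebra.

Set Implicit Arguments.
Unset Strict Implicit.
Unset Printing Implicit Defensive.

Import GRing.Theory.
Local Open Scope ring_scope.

(* A finite simple graph is a symmetric irreflexive relation on a finType. *)

(* [ordS] is the successor modulo k. For k >= 3 this is a 2-regular graph;
   the definition is degenerate for k <= 2. *)
Definition cycle_adj (k : nat) : rel 'I_k :=
  fun i j => (j == ordS i) || (i == ordS j).

Definition cartesian_adj (S T : finType) (e : rel S) (f : rel T) :
    rel (S * T)%type :=
  fun p q => ((p.1 == q.1) && f p.2 q.2) || ((p.2 == q.2) && e p.1 q.1).

(* No cardinality hypothesis is needed: [bijective l] forces #|Gamma| = #|V|. *)
Definition distance_magic_labeling (V : finType) (e : rel V)
    (Gamma : finZmodType) (l : V -> Gamma) : Prop :=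
  bijective l /\ exists mu : Gamma, forall v : V, \sum_(u | e v u) l u = mu.

Lemma cycle_adj_sym (k : nat) : symmetric (@cycle_adj k).
Proof. by move=> i j; rewrite /cycle_adj orbC. Qed.

Lemma cycle_adj_irr (k : nat) : (1 < k)%N -> irreflexive (@cycle_adj k).
Proof.
move=> k_gt1 i; rewrite /cycle_adj orbb; apply/negbTE/eqP => /(congr1 val) /=.
have := ltn_ord i; rewrite leq_eqVlt => /orP[/eqP Ek | ltk].
  by rewrite Ek modnn => i0; move: k_gt1; rewrite -Ek i0.
by rewrite modn_small // => /eqP; rewrite -[X in X == _]addn0 -addn1 eqn_add2l.
Qed.

Lemma cartesian_adj_sym (S T : finType) (e : rel S) (f : rel T) :
  symmetric e -> symmetric f -> symmetric (cartesian_adj e f).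
Proof.
move=> sym_e sym_f p q.
by rewrite /cartesian_adj sym_e sym_f (eq_sym p.1) (eq_sym p.2).
Qed.

Lemma cartesian_adj_irr (S T : finType) (e : rel S) (f : rel T) :
  irreflexive e -> irreflexive f -> irreflexive (cartesian_adj e f).
Proof. by move=> irr_e irr_f p; rewrite /cartesian_adj irr_e irr_f !andbF. Qed.

(* Main.v *)
(** Write [x], [y] for the two unit shifts of the torus.  In characteristic 2 the
    neighbourhood-sum operator is [L = x + x^-1 + y + y^-1], and its iterated
    squares are [L^(2^k) = x^(2^k) + x^-(2^k) + y^(2^k) + y^-(2^k)].  A labeling
    [l] with [L l] constant satisfies [L^(2^k) l = 0] for [k >= 1]; for
    [k = m - 1] the two [x]-terms agree, so by injectivity [y^(2^m) = 1] and
    [n <= m].  By symmetry [m = n].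

    Conversely, up to a unit [L] is [(x + y) (1 + x y)], which kills every
    function of [i + j] and every function of [i - j].  Modulo [M = 2^m] these two
    values have the same parity and determine [(i, j)] up to the shift by
    [(M/2, M/2)], so one more bit is needed.  It is the bit [[i < j] + [M <= i + j]],
    which that shift flips; it is killed by [L] because its increment along
    [(1, 1)] depends only on [i + j]. *)
Require Import Defs.
From mathcomp Require Import all_boot all_algebra.
From mathcomp Require Import zify ring.

Set Implicit Arguments.
Unset Strict Implicit.
Unset Printing Implicit Defensive.

Import GRing.Theory.
Local Open Scope ring_scope.

(** * Neighbourhood sums on the torus *)

Lemma val_ordS_if k (i : 'I_k) :
  ordS i = (if i.+1 == k then 0 else i.+1) :> nat.
Proof.
case: eqP => [/= -> | ne]; first by rewrite modnn.
by rewrite /= modn_small //; have := ltn_ord i; lia.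
Qed.

Lemma val_ord_pred_if k (i : 'I_k) :
  ord_pred i = (if i == 0 :> nat then k.-1 else i.-1) :> nat.
Proof.
have ltik := ltn_ord i; case: eqP => [/= -> | ne /=].
  by rewrite add0n modn_small //; lia.
by rewrite (_ : (i + k).-1 = i.-1 + k)%N ?modnDr ?modn_small //; lia.
Qed.

Lemma val_iter_ordS k t (i : 'I_k) : iter t (@ordS k) i = ((i + t) %% k)%N :> nat.
Proof.
elim: t => [|t IHt] /=; first by rewrite addn0 modn_small.
by rewrite IHt -addn1 modnDml addn1 addnS.
Qed.

Lemma cycle_adjE k (i : 'I_k) :
  cycle_adj i =1 [pred j | (j == ordS i) || (j == ord_pred i)].
Proof.
move=> j; rewrite /cycle_adj /=; congr (_ || _).
by rewrite -[RHS](inj_eq (can_inj (@ordSK k))) ord_predK eq_sym.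
Qed.

Lemma sum_cycle_adj (V : nmodType) k (i : 'I_k) (F : 'I_k -> V) : (2 < k)%N ->
  \sum_(j | cycle_adj i j) F j = F (ordS i) + F (ord_pred i).
Proof.
move=> k_gt2; rewrite (eq_bigl _ _ (cycle_adjE i)) (bigD1 (ordS i)) /= ?eqxx //.
congr (_ + _); apply: big_pred1 => j /=.
(* Here [2 < k] matters: on a cycle of length 2 both neighbours coincide. *)
have neq : ord_pred i != ordS i.
  have ltik := ltn_ord i.
  by apply/eqP => /(congr1 (@nat_of_ord k)); rewrite val_ord_pred_if val_ordS_if; do 2!case: eqP; lia.
have [-> | _] := eqVneq j (ord_pred i); first by rewrite orbT neq.
by rewrite orbF andbN.
Qed.

(** Irreflexivity of [e] makes the two clauses of the adjacency disjoint, so the sum splits on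
    whether the first coordinate moves. *)
Lemma sum_cartesian_adj (V : nmodType) (S T : finType) (e : rel S) (f : rel T)
    (p : S * T) (F : S * T -> V) : irreflexive e ->
  \sum_(q | cartesian_adj e f p q) F q =
    \sum_(j | f p.2 j) F (p.1, j) + \sum_(i | e p.1 i) F (i, p.2).
Proof.
case: p => a b /= irr_e.
rewrite (bigID (fun q => q.1 == a)) /=; congr (_ + _).
  rewrite (reindex_omap (fun j => (a, j)) (fun q => Some q.2)) /=.
    apply: eq_bigl => j; rewrite /cartesian_adj /= !eqxx irr_e andbF orbF andbT.
    by rewrite andbT.
  by move=> [q1 q2] /= /andP[_ /eqP->].
rewrite (reindex_omap (fun i => (i, b)) (fun q => Some q.1)) /=.
  apply: eq_bigl => i; rewrite /cartesian_adj /= !eqxx andbT (eq_sym a i).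
  by case: (eqVneq i a) => [->|_] /=; rewrite ?irr_e ?andbF ?andbT.
move=> [q1 q2] /=; rewrite /cartesian_adj /= (eq_sym a) => /andP[].
by case: (q1 == a) => //= /andP[/eqP-> _].
Qed.

Lemma sum_torus_adj (V : nmodType) a b (i : 'I_a) (j : 'I_b)
    (F : 'I_a * 'I_b -> V) : (2 < a)%N -> (2 < b)%N ->
  \sum_(q | cartesian_adj (@cycle_adj a) (@cycle_adj b) (i, j) q) F q =
  F (ordS i, j) + F (ord_pred i, j) + (F (i, ordS j) + F (i, ord_pred j)).
Proof.
move=> a_gt2 b_gt2; rewrite sum_cartesian_adj; last exact: cycle_adj_irr (ltnW a_gt2).
by rewrite addrC !sum_cycle_adj.
Qed.

(** * Necessity: repeated squaring in characteristic 2 *)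

Section ShiftSquares.

Variables (R : comNzRingType) (I J : Type) (f : I -> J -> R).
Hypothesis char2 : 2%:R = 0 :> R.

(** Adding the hypothesis at the four neighbours of [(i, j)] gives the wanted sum, plus [f i j] four
    times and each mixed term twice; the total [4 mu] vanishes as well. *)
Lemma shift_sum_double (s p : I -> I) (s' p' : J -> J) (mu : R) :
  cancel s p -> cancel p s -> cancel s' p' -> cancel p' s' ->
  (forall i j, f (s i) j + f (p i) j + (f i (s' j) + f i (p' j)) = mu) ->
  forall i j, f (s (s i)) j + f (p (p i)) j + (f i (s' (s' j)) + f i (p' (p' j))) = 0.
Proof.
move=> sK pK s'K p'K sum_f i j.
have E1 := sum_f (s i) j; have E2 := sum_f (p i) j.
have E3 := sum_f i (s' j); have E4 := sum_f i (p' j).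
rewrite sK in E1; rewrite pK in E2; rewrite s'K in E3; rewrite p'K in E4.
transitivity (2%:R * (2%:R * mu - 2%:R * f i j - f (s i) (s' j) - f (s i) (p' j)
   - f (p i) (s' j) - f (p i) (p' j))); last by rewrite char2 mul0r.
transitivity (mu + mu + mu + mu - 2%:R * (2%:R * f i j + f (s i) (s' j)
   + f (s i) (p' j) + f (p i) (s' j) + f (p i) (p' j))); last by ring.
rewrite -{1}E1 -{1}E2 -{1}E3 -{1}E4; ring.
Qed.

Lemma iter_cancel (T : Type) (s p : T -> T) t : cancel s p -> cancel (iter t s) (iter t p).
Proof. by move=> sK; elim: t => // t IHt i; rewrite iterSr /= sK IHt. Qed.

Lemma shift_sum_pow2 (s p : I -> I) (s' p' : J -> J) (mu : R) :
  cancel s p -> cancel p s -> cancel s' p' -> cancel p' s' ->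
  (forall i j, f (s i) j + f (p i) j + (f i (s' j) + f i (p' j)) = mu) ->
  forall k i j, let t := (2 ^ k.+1)%N in
  f (iter t s i) j + f (iter t p i) j + (f i (iter t s' j) + f i (iter t p' j)) = 0.
Proof.
move=> sK pK s'K p'K sum_f; elim=> [|k IHk] i j t.
  exact: (shift_sum_double sK pK s'K p'K sum_f).
rewrite /t expnS mul2n -addnn !iterD.
by apply: shift_sum_double IHk _ _; apply: iter_cancel.
Qed.

End ShiftSquares.

Lemma char_Z2 : 2%:R = 0 :> 'Z_2.
Proof. exact/val_inj. Qed.

Lemma addrr_Z2 (x : 'Z_2) : x + x = 0.
Proof. by rewrite -mulr2n -mulr_natl char_Z2 mul0r. Qed.

Lemma shift_sum_leq (d m n : nat) (f : 'I_(2 ^ m) -> 'I_(2 ^ n) -> 'rV['Z_2]_d)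
    (mu : 'rV['Z_2]_d) : (2 <= m)%N ->
  (forall i, injective (f i)) ->
  (forall i j, f (ordS i) j + f (ord_pred i) j + (f i (ordS j) + f i (ord_pred j)) = mu) ->
  (n <= m)%N.
Proof.
case: m f => [|[|m]] // f _ inj_f sum_f.
pose t := (2 ^ m.+1)%N.
have tt : (t + t = 2 ^ m.+2)%N by rewrite addnn -mul2n -expnS.
have i0 : 'I_(2 ^ m.+2) by apply: (@Ordinal _ 0); rewrite expn_gt0.
have j0 : 'I_(2 ^ n) by apply: (@Ordinal _ 0); rewrite expn_gt0.
(* [t] is half the length of the first cycle, so [t] steps either way reach the antipode. *)
have Si : iter t (@ordS _) i0 = iter t (@ord_pred _) i0.
  rewrite -[LHS](iter_cancel t (@ordSK (2 ^ m.+2))) -iterD tt.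
  congr (iter t _ _); apply: val_inj.
  by rewrite /= [LHS]val_iter_ordS modnDr modn_small.
(* The two terms shifted in [i] cancel in each coordinate, leaving two equal labels in row [i0]. *)
have Sj : iter t (@ordS _) j0 = iter t (@ord_pred _) j0.
  apply: (inj_f i0); apply/rowP => c.
  have sum_c i j : f (ordS i) j 0 c + f (ord_pred i) j 0 c
      + (f i (ordS j) 0 c + f i (ord_pred j) 0 c) = mu 0 c.
    by rewrite -(sum_f i j) !mxE.
  have := @shift_sum_pow2 _ _ _ (fun i j => f i j 0 c) char_Z2 _ _ _ _ _
    (@ordSK _) (@ord_predK _) (@ordSK _) (@ord_predK _) sum_c m i0 j0.
  rewrite -/t /= Si addrr_Z2 add0r => /eqP; rewrite addr_eq0 => /eqP->.
  by apply/esym/eqP; rewrite -addr_eq0 addrr_Z2.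
have /(congr1 val) : iter (t + t) (@ordS _) j0 = j0.
  by rewrite iterD Sj; apply: iter_cancel (@ord_predK _) _.
rewrite /= val_iter_ordS tt => jE.
suff : (2 ^ n %| 2 ^ m.+2)%N by rewrite dvdn_Pexp2l.
have : (j0 + 2 ^ m.+2 == j0 + 0 %[mod 2 ^ n])%N by rewrite jE addn0 modn_small.
by rewrite eqn_modDl mod0n.
Qed.

(** * Sufficiency: an explicit labeling *)

Lemma eq_from_bits m (a b : nat) : (a < 2 ^ m)%N -> (b < 2 ^ m)%N ->
  (forall k, (k < m)%N -> odd (a %/ 2 ^ k) = odd (b %/ 2 ^ k)) -> a = b.
Proof.
elim: m a b => [|m IHm] a b; first by rewrite expn0; lia.
rewrite expnS => lta ltb bits.
have half : (a %/ 2 = b %/ 2)%N.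
  apply: IHm => [||k ltkm]; try lia.
  by have := bits k.+1 ltkm; rewrite expnS !divnMA.
have := bits 0%N isT; rewrite expn0 !divn1; lia.
Qed.

Section Labeling.

Variable M : nat.

(** Reduction modulo [M] is written with conditionals, so that wrap-around is settled by case splits
    and [lia]. *)
Definition sum_mod (i j : nat) := (if i + j < M then i + j else i + j - M)%N.
Definition diff_mod (i j : nat) := (if j <= i then i - j else i + M - j)%N.
Definition sheet (i j : nat) : bool := (i < j)%N (+) (M <= i + j)%N.

Lemma sum_mod_lt (i j : 'I_M) : (sum_mod i j < M)%N.
Proof. by have [] := (ltn_ord i, ltn_ord j); rewrite /sum_mod; case: ifP; lia. Qed.

Lemma diff_mod_lt (i j : 'I_M) : (diff_mod i j < M)%N.
Proof. by have [] := (ltn_ord i, ltn_ord j); rewrite /diff_mod; case: ifP; lia. Qed.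

Lemma sum_mod_ordS (i j : 'I_M) : sum_mod (ordS i) j = sum_mod i (ordS j).
Proof.
have [] := (ltn_ord i, ltn_ord j); rewrite /sum_mod !val_ordS_if; repeat case: ifP; lia.
Qed.

Lemma sum_mod_ord_pred (i j : 'I_M) : sum_mod (ord_pred i) j = sum_mod i (ord_pred j).
Proof.
have [] := (ltn_ord i, ltn_ord j); rewrite /sum_mod !val_ord_pred_if; repeat case: ifP; lia.
Qed.

Lemma diff_mod_ordS (i j : 'I_M) : diff_mod (ordS i) j = diff_mod i (ord_pred j).
Proof.
have [] := (ltn_ord i, ltn_ord j).
rewrite /diff_mod !val_ord_pred_if !val_ordS_if; repeat case: ifP; lia.
Qed.

Lemma diff_mod_ord_pred (i j : 'I_M) : diff_mod (ord_pred i) j = diff_mod i (ordS j).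
Proof.
have [] := (ltn_ord i, ltn_ord j).
rewrite /diff_mod !val_ord_pred_if !val_ordS_if; repeat case: ifP; lia.
Qed.

Lemma sheet_sum (i j : 'I_M) : (2 < M)%N ->
  sheet (ordS i) j (+) sheet (ord_pred i) j =
  sheet i (ordS j) (+) sheet i (ord_pred j).
Proof.
have [] := (ltn_ord i, ltn_ord j).
rewrite /sheet !val_ord_pred_if !val_ordS_if; repeat case: ifP; lia.
Qed.

Lemma sum_diff_sheet_inj (i j i' j' : 'I_M) : ~~ odd M ->
  sum_mod i j = sum_mod i' j' -> (diff_mod i j %/ 2 = diff_mod i' j' %/ 2)%N ->
  sheet i j = sheet i' j' -> (i, j) = (i', j').
Proof.
move=> evM; have := (ltn_ord i, ltn_ord j, ltn_ord i', ltn_ord j').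
rewrite /sum_mod /diff_mod /sheet => -[[[lti ltj] lti'] ltj'] Es Ed Ec.
by congr (_, _); apply: val_inj => /=; move: Es Ed Ec; repeat case: ifP; lia.
Qed.

End Labeling.

(** The lowest bit of the difference repeats that of the sum, so its slot is free for [sheet]. *)
Definition torus_label m (p : 'I_(2 ^ m) * 'I_(2 ^ m)) : 'rV['Z_2]_(m + m) :=
  row_mx (\row_k (odd (sum_mod (2 ^ m) p.1 p.2 %/ 2 ^ k))%:R)
         (\row_k (if k == 0 :> nat then sheet (2 ^ m) p.1 p.2
                  else odd (diff_mod (2 ^ m) p.1 p.2 %/ 2 ^ k))%:R).

Lemma bool_Z2_inj : injective (fun b : bool => b%:R : 'Z_2).
Proof. by case; case. Qed.

Lemma natr_addb_Z2 (a b : bool) : a%:R + b%:R = (a (+) b)%:R :> 'Z_2.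
Proof. by case: a; case: b; apply/val_inj. Qed.

Lemma torus_label_inj m : (0 < m)%N -> injective (@torus_label m).
Proof.
move=> m_gt0 [i j] [i' j'] /eq_row_mx[/rowP Es /rowP Ed].
have mE : (2 ^ m = 2 * 2 ^ m.-1)%N by rewrite -expnS prednK.
apply: sum_diff_sheet_inj.
- by rewrite mE oddM.
- apply: (@eq_from_bits m); try exact: sum_mod_lt.
  by move=> k ltkm; have := Es (Ordinal ltkm); rewrite !mxE => /bool_Z2_inj.
- have [lt1 lt2] := (diff_mod_lt i j, diff_mod_lt i' j').
  (* Bit [k] of the halved difference is bit [k.+1] of the difference, which the label stores. *)
  apply: (@eq_from_bits m.-1); try lia.
  move=> k ltkm; have ltk : (k.+1 < m)%N by lia.
  have := Ed (Ordinal ltk); rewrite !mxE /= => /bool_Z2_inj.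
  by rewrite expnS !divnMA.
- by have := Ed (Ordinal m_gt0); rewrite !mxE /= => /bool_Z2_inj.
Qed.

Lemma torus_label_magic m : (2 <= m)%N ->
  distance_magic_labeling
    (cartesian_adj (@cycle_adj (2 ^ m)) (@cycle_adj (2 ^ m))) (@torus_label m).
Proof.
move=> m_ge2; have M_gt2 : (2 < 2 ^ m)%N by apply: leq_trans (leq_pexp2l _ m_ge2).
split.
  apply: inj_card_bij; first by apply: torus_label_inj; lia.
  by rewrite card_mx card_prod !card_ord mul1n expnD.
(* The four terms cancel in pairs: a step in [i] acts on the sum like the same step in [j], and on
   the difference like the opposite one. *)
exists 0 => -[i j]; rewrite sum_torus_adj //; apply/rowP => c.
rewrite !mxE; case: split => k; rewrite !mxE /=.
  rewrite sum_mod_ordS sum_mod_ord_pred; exact: addrr_Z2.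
case: ifP => _; last first.
  rewrite diff_mod_ordS diff_mod_ord_pred [X in X + _]addrC; exact: addrr_Z2.
by rewrite !natr_addb_Z2 sheet_sum // addbb.
Qed.

Theorem theorem3p6 (m n : nat) (hm : (2 <= m)%N) (hn : (2 <= n)%N) :
  (exists l : 'I_(2 ^ m) * 'I_(2 ^ n) -> 'rV['Z_2]_(m + n),
     distance_magic_labeling
       (cartesian_adj (@cycle_adj (2 ^ m)) (@cycle_adj (2 ^ n))) l)
  <-> m = n.
Proof.
split=> [[l [/bij_inj inj_l [mu magic_l]]] | <-]; last first.
  by exists (@torus_label m); apply: torus_label_magic.
have pow_gt2 k : (2 <= k)%N -> (2 < 2 ^ k)%N.
  by move=> k_ge2; apply: leq_trans (leq_pexp2l _ k_ge2).
have sum_l i j : l (ordS i, j) + l (ord_pred i, j)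
    + (l (i, ordS j) + l (i, ord_pred j)) = mu.
  by rewrite -(magic_l (i, j)) sum_torus_adj ?pow_gt2.
apply/eqP; rewrite eqn_leq; apply/andP; split.
  apply: (@shift_sum_leq _ n m (fun j i => l (i, j)) mu) => //.
    by move=> j i i' /inj_l[].
  by move=> j i; rewrite addrC.
apply: (@shift_sum_leq _ m n (fun i j => l (i, j)) mu) => //.
by move=> i j j' /inj_l[].
Qed.
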